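(* For every interface $\sigma_{KL}$ of the mesh and all $(u,v)\in\Omega^2$, one has $$X_{KL}(u,v)-\xi_{KL}(u,v)\ \ge\ \frac{\beta_0}{2\lambda^\star}\,\big|G_{KL}(u,v)-f(u)\cdot n_{KL}\big|^2,$$ where $X_{KL}(u,v):=\xi(u)\cdot n_{KL}+D\eta(u)\big(G_{KL}(u,v)-f(u)\cdot n_{KL}\big)$.
   Context: $\Omega\subset\mathbb R^m$ is a convex bounded set; $f_\alpha\in C^2(\overline\Omega;\mathbb R^m)$ ($1\le\alpha\le d$) and each $Df_\alpha$ is diagonalizable with real eigenvalues. $\eta\in C^2(\overline\Omega;\mathbb R)$, $\eta\ge0$, satisfies $\mathrm{spec}(D^2\eta(u))\subset[\beta_0;\beta_1]$ for all $u\in\overline\Omega$, where $\beta_1\ge\beta_0>0$, and $\xi=(\xi_\alpha)_\alpha\in C^2(\overline\Omega;\mathbb R^d)$ satisfies $D\xi_\alpha(u)=D\eta(u)Df_\alpha(u)$ on $\Omega$. For $n\in\mathbb R^d$: $f(u)\cdot n=\sum_\alpha n_\alpha f_\alpha(u)\in\mathbb R^m$, $\xi(u)\cdot n=\sum_\alpha n_\alpha\xi_\alpha(u)$. Mesh. $\mathcal T$ is a family of disjoint polygonal/polyhedral connected cells of $\mathbb R^d$, the union of whose closures is $\mathbb R^d$. $\mathcal N(K)$ is the set of cells neighbouring $K$; for $L\in\mathcal N(K)$, $\sigma_{KL}$ is the common interface and $n_{KL}$ its unit normal from $K$ to $L$. Numerical fluxes. For each $K\in\mathcal T$, $L\in\mathcal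 N(K)$, $G_{KL}:\Omega^2\to\mathbb R^m$ is Lipschitz continuous, with $G_{KL}(u,v)=-G_{LK}(v,u)$ and $G_{KL}(u,u)=f(u)\cdot n_{KL}$. There is $\lambda^\star>0$ such that: (i) for all $\lambda>\lambda^\star$ and all $(u,v)\in\Omega^2$, $u-\frac1\lambda(G_{KL}(u,v)-f(u)\cdot n_{KL})\in\Omega$; (ii) there are Lipschitz continuous $\xi_{KL}:\Omega^2\to\mathbb R$ with $\xi_{KL}(u,v)=-\xi_{LK}(v,u)$ and, for all $\lambda\ge\lambda^\star$ and $(u,v)\in\Omega^2$, $$\xi_{KL}(u,v)-\xi(u)\cdot n_{KL}\le-\lambda\Big(\eta\big(u-\tfrac1\lambda(G_{KL}(u,v)-f(u)\cdot n_{KL})\big)-\eta(u)\Big).$$ *)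

(* Defs.v *)
From HB Require Import structures.
From mathcomp Require Import all_boot all_order all_algebra.
From mathcomp Require Import all_classical all_reals all_analysis.

Set Implicit Arguments.
Unset Strict Implicit.
Unset Printing Implicit Defensive.

Import Order.TTheory GRing.Theory Num.Theory.
Import numFieldNormedType.Exports.

Local Open Scope classical_set_scope.
Local Open Scope ring_scope.

(* The norm `|_| of 'rV[R]_n is the sup norm. It is only used through notions
   that do not depend on the choice of an equivalent norm (topology,
   differentiability, boundedness, Lipschitz continuity). *)
Definition dotp (R : realType) (n : nat) (x y : 'rV[R]_n) : R :=
  \sum_(i < n) x 0 i * y 0 i.

Definition enorm (R : realType) (n : nat) (x : 'rV[R]_n) : R :=
  Num.sqrt (dotp x x).

Definition C1_on (R : realType) (V W : normedModType R) (U : set V)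
    (f : V -> W) : Prop :=
  forall x, U x ->
    differentiable f x /\ forall v, {for x, continuous ('D_v f)}.

(* C^2(A) for A closed (not necessarily the closure of an open set): f agrees
   with a function of class C^2 near A. Functions are total, so f itself is
   taken to be this function and its derivatives on A are the usual ones. *)
Definition C2_closed (R : realType) (V W : normedModType R) (A : set V)
    (f : V -> W) : Prop :=
  exists U : set V,
    [/\ open U, A `<=` U, C1_on U f & forall v, C1_on U ('D_v f)].

Definition hessian (R : realType) (m : nat) (g : 'rV[R]_m -> R)
    (u : 'rV[R]_m) : 'M[R]_m :=
  \matrix_(i < m, j < m) 'D_(delta_mx 0 i) ('D_(delta_mx 0 j) g) u.

Definition flux_dot (R : realType) (d m : nat)
    (f : 'I_d -> 'rV[R]_m -> 'rV[R]_m) (u : 'rV[R]_m) (n : 'rV[R]_d) :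
    'rV[R]_m :=
  \sum_(a < d) n 0 a *: f a u.

Definition entropy_flux_dot (R : realType) (d m : nat)
    (xi : 'I_d -> 'rV[R]_m -> R) (u : 'rV[R]_m) (n : 'rV[R]_d) : R :=
  \sum_(a < d) n 0 a * xi a u.

(* Finite unions of finite intersections of half-spaces; the third component
   of ((a, b), c) tells whether the half-space a . x <= b is closed. *)
Definition polyhedral (R : realType) (d : nat) (A : set 'rV[R]_d) : Prop :=
  exists P : seq (seq ('rV[R]_d * R * bool)),
    A = [set x | has (all (fun h => dotp h.1.1 x < h.1.2 ?<= if h.2)) P].

(* A `<=` closure A° means that A is full-dimensional. Cells may be open or
   contain some of their boundary points, and need not be convex. *)
Definition is_cell (R : realType) (d : nat) (A : set 'rV[R]_d) : Prop :=
  [/\ A !=set0, polyhedral A, A `<=` closure A° & connected A].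

Definition is_mesh (R : realType) (d : nat) (T : Type)
    (cell : T -> set 'rV[R]_d) : Prop :=
  [/\ forall K, is_cell (cell K),
      trivIset setT cell &
      \bigcup_(K in setT) closure (cell K) = setT].

(* Near x, A and B lie on the two sides of the hyperplane through x normal to
   n, and n points from A to B. *)
Definition separated_at (R : realType) (d : nat) (A B : set 'rV[R]_d)
    (n x : 'rV[R]_d) : Prop :=
  \forall y \near x,
    (dotp (y - x) n < 0 -> A y) /\ (0 < dotp (y - x) n -> B y).

(* The common interface of A and B, up to its relative boundary: points where
   A and B touch only along a set of codimension at least 2 are excluded. *)
Definition interface (R : realType) (d : nat) (A B : set 'rV[R]_d) :
    set 'rV[R]_d :=
  [set x | exists2 n, enorm n = 1 & separated_at A B n x].

Definition neighbours (R : realType) (d : nat) (T : Type)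
    (cell : T -> set 'rV[R]_d) (K : T) : set T :=
  [set L | L <> K /\ interface (cell K) (cell L) !=set0].

Definition is_interface_normal (R : realType) (d : nat) (T : Type)
    (cell : T -> set 'rV[R]_d) (n : T -> T -> 'rV[R]_d) : Prop :=
  forall K L, neighbours cell K L ->
    enorm (n K L) = 1 /\
    forall x, interface (cell K) (cell L) x ->
      separated_at (cell K) (cell L) (n K L) x.

(* Main.v *)
Require Import Defs.
From HB Require Import structures.
From mathcomp Require Import all_boot all_order all_algebra.
From mathcomp Require Import all_classical all_reals all_analysis.
From mathcomp Require Import ring lra.

Set Implicit Arguments.
Unset Strict Implicit.
Unset Printing Implicit Defensive.

Import Order.TTheory GRing.Theory Num.Theory.
Import numFieldNormedType.Exports.

Local Open Scope classical_set_scope.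
Local Open Scope ring_scope.

(** Write w = G_KL(u,v) - f(u).n_KL. The entropy inequality with parameter
    lambda bounds X_KL - xi_KL from below by lambda times the remainder of the
    first-order Taylor expansion of eta between u and u - w / lambda:
    << X_KL - xi_KL >= lambda (eta(u - w / lambda) - eta(u) + D eta(u) w / lambda) >>.
    Since the spectrum of the Hessian is at least beta0, this remainder is at
    least beta0 / 2 |w / lambda| ^ 2 ([taylor_hessian_lower]), so that
    X_KL - xi_KL >= beta0 / (2 lambda) |w| ^ 2.

    The argument is run for lambda = lstar / t with 0 < t < 1, for which the
    segment from u to u - w / lambda lies in Omega: its points are the states
    u - w / lambda' with lambda' >= lambda > lstar. Letting t tend to 1 gives the
    constant beta0 / (2 lstar).

    The Taylor bound along a segment rests on two classical facts: the Hessian of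
    a C^2 function is symmetric ([derive2_sym]), and the quadratic form of a
    symmetric real matrix is bounded from below by any lower bound of its
    eigenvalues ([min_eigenvalue_le_quad]). *)

(** * Euclidean scalar product and symmetric matrices *)

Section Dotp.
Variables (R : realType) (m : nat).
Implicit Types (x y z : 'rV[R]_m) (A : 'M[R]_m) (a : R).

Lemma dotpE x y : dotp x y = (x *m y^T) 0 0.
Proof. by rewrite mxE; apply: eq_bigr => i _; rewrite mxE. Qed.

Lemma dotpC x y : dotp x y = dotp y x.
Proof. by apply: eq_bigr => i _; rewrite mulrC. Qed.

Lemma dotpDl x y z : dotp (x + y) z = dotp x z + dotp y z.
Proof. by rewrite !dotpE mulmxDl mxE. Qed.

Lemma dotpZl a x y : dotp (a *: x) y = a * dotp x y.
Proof. by rewrite !dotpE -scalemxAl mxE. Qed.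

Lemma dotpDr x y z : dotp z (x + y) = dotp z x + dotp z y.
Proof. by rewrite dotpC dotpDl !(dotpC z). Qed.

Lemma dotpZr a x y : dotp y (a *: x) = a * dotp y x.
Proof. by rewrite dotpC dotpZl (dotpC y). Qed.

Lemma dotp_ge0 x : 0 <= dotp x x.
Proof. by apply: sumr_ge0 => i _; rewrite -expr2 sqr_ge0. Qed.

Lemma dotp_eq0 x : dotp x x = 0 -> x = 0.
Proof.
move/eqP; rewrite psumr_eq0 => [/allP xx0|i _]; last by rewrite -expr2 sqr_ge0.
apply/rowP => i; rewrite mxE.
by have := xx0 i (mem_index_enum i); rewrite mulf_eq0 orbb => /eqP.
Qed.

Lemma dotp0l x : dotp 0 x = 0.
Proof. by rewrite -(scale0r 0) dotpZl mul0r. Qed.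

Lemma enorm_sqr x : enorm x ^+ 2 = dotp x x.
Proof. by rewrite sqr_sqrtr// dotp_ge0. Qed.

Lemma dotp_mulmx_sym A x y :
  A^T = A -> dotp (x *m A) y = dotp (y *m A) x.
Proof.
by move=> AT; rewrite dotpE dotpC dotpE trmx_mul AT mulmxA.
Qed.

Lemma continuous_quad A : continuous (fun x : 'rV[R]_m => dotp (x *m A) x).
Proof.
have -> : (fun y : 'rV[R]_m => dotp (y *m A) y) =
    (fun y => \sum_(i < m) (\sum_(j < m) y 0 j * A j i) * y 0 i).
  by apply/funext => y; apply: eq_bigr => i _; rewrite mxE.
have add_cont := @add_continuous R.
apply (@continuous_big R _ +%R 0 xpredT add_cont 'rV[R]_m) => i _ x.
apply: (cvgM (F := nbhs x)); last exact: coord_continuous.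
move: x; apply (@continuous_big R _ +%R 0 xpredT add_cont 'rV[R]_m) => j _ x.
by apply: (cvgMr_tmp (F := nbhs x)); exact: coord_continuous.
Qed.

Lemma compact_sphere : compact [set x : 'rV[R]_m | dotp x x = 1].
Proof.
apply: bounded_closed_compact.
  exists 1; split => // M M1 x /= xx1.
  rewrite -[leLHS]/(mx_norm x) mx_normrE.
  apply/bigmax_leP; split=> [|[i j] _ /=]; first lra.
  rewrite ord1.
  suff : `|x 0 j| ^+ 2 <= 1 by rewrite expr_le1// => ?; lra.
  rewrite real_normK ?num_real// -xx1 /dotp (bigD1 j)//= -expr2 lerDl.
  by apply: sumr_ge0 => k _; rewrite -expr2 sqr_ge0.
have -> : [set x : 'rV[R]_m | dotp x x = 1] =
    (fun x => dotp (x *m 1%:M) x) @^-1` [set 1].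
  by apply/seteqP; split => x /=; rewrite mulmx1.
apply: closed_comp; last exact: closed_eq.
by move=> x _; exact: continuous_quad.
Qed.

(** The minimum c of x A x^T over the unit sphere exists by compactness, and it
    is an eigenvalue of A: the quadratic form of A - c is nonnegative and
    vanishes at a minimizer v, so its gradient at v, which is 2 (v A - c v) by
    symmetry of A, must vanish. *)
Lemma min_eigenvalue_le_quad A b : A^T = A ->
  (forall l, eigenvalue A l -> b <= l) ->
  forall x, b * dotp x x <= dotp (x *m A) x.
Proof.
move=> AT spec x; have [->|x0] := eqVneq x 0.
  by rewrite mul0mx !dotp0l mulr0.
have normalise y : y != 0 ->
    exists2 k : R, dotp (k *: y) (k *: y) = 1 & k != 0.
  move=> y0; have yy0 : 0 < dotp y y.
    by rewrite lt_def dotp_ge0 andbT; apply: contra_neq y0; exact: dotp_eq0.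
  exists (enorm y)^-1; last by rewrite invr_neq0// gt_eqF// sqrtr_gt0.
  by rewrite dotpZl dotpZr mulrA -expr2 exprVn enorm_sqr mulVf// gt_eqF.
have [|v vv1 vmin] := @EVT_min_rV R m _ _ _ compact_sphere
    (continuous_subspaceT (continuous_quad (A := A))).
  by have [k k1 _] := normalise _ x0; exists (k *: x).
move: vv1; rewrite inE /= => vv1; set c := dotp (v *m A) v in vmin.
have qle y : c * dotp y y <= dotp (y *m A) y.
  have [->|y0] := eqVneq y 0.
    by rewrite mul0mx !dotp0l mulr0.
  have [k k1 k0] := normalise _ y0.
  have k2 : 0 < k ^+ 2 by rewrite exprn_even_gt0.
  have := vmin (k *: y); rewrite inE /= => /(_ k1).
  rewrite -scalemxAl dotpZl dotpZr mulrA -expr2 => ck.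
  move: k1; rewrite dotpZl dotpZr mulrA -expr2 => k1.
  by rewrite -(ler_pM2l k2) mulrCA k1 mulr1.
have [z zE] : exists z, z = v *m A - c *: v by exists (v *m A - c *: v).
have vz y : dotp (v *m A) y = dotp z y + c * dotp v y.
  by rewrite -dotpZl -dotpDl zE subrK.
(* The nonnegative form of A - c, evaluated at v + t z. *)
have rz t : 0 <= 2 * t * dotp z z + t ^+ 2 * (dotp (z *m A) z - c * dotp z z).
  have := qle (v + t *: z).
  rewrite mulmxDl -scalemxAl !(dotpDl, dotpDr, dotpZl, dotpZr).
  rewrite (dotp_mulmx_sym z v AT) -/c !vz vv1 (dotpC z v).
  by lra.
have z0 : z = 0.
  apply: dotp_eq0; apply/eqP; rewrite eq_le dotp_ge0 andbT.
  set r := _ - _ in rz; have r0 : 0 <= r by rewrite subr_ge0.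
  rewrite leNgt; apply/negP => zz0.
  have r1 : 0 < r + 1 by lra.
  (* At t = - s the linear term of rz beats the quadratic one. *)
  pose s := dotp z z / (r + 1).
  have s0 : 0 < s by rewrite divr_gt0.
  have sr : s * (r + 1) = dotp z z by rewrite divfK// gt_eqF.
  have := rz (- s).
  rewrite [leRHS](_ : _ = - (s * (dotp z z + s))); last by rewrite -sr; ring.
  by rewrite oppr_ge0 leNgt mulr_gt0 ?addr_gt0.
apply: le_trans (qle x); apply: ler_wpM2r; first exact: dotp_ge0.
apply: spec; apply/eigenvalueP; exists v.
  by apply/eqP; rewrite -subr_eq0 -zE z0.
apply/eqP => v0; move: vv1.
by rewrite v0 dotp0l => /eqP; rewrite eq_sym oner_eq0.
Qed.

End Dotp.

(** * Second-order Taylor bound on an interval *)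

Lemma is_derive_line (R : realType) (V : normedModType R) (g : V -> R)
    (a v : V) (s : R) : derivable g (a + s *: v) v ->
  is_derive s 1 (fun r => g (a + r *: v)) ('D_v g (a + s *: v)).
Proof.
move=> dg.
have E : (fun h : R => h^-1 *: (g (a + (h *: 1 + s) *: v) - g (a + s *: v))) =
         (fun h : R => h^-1 *: (g (h *: v + (a + s *: v)) - g (a + s *: v))).
  apply/funext => h; congr (_ *: (g _ - _)).
  by rewrite scalerDl [h *: 1]mulr1 addrCA.
by split; rewrite /derivable /derive /= E.
Qed.

Lemma MVT_derivable (R : realType) (p p' : R -> R) (a b : R) : a <= b ->
  (forall x, x \in `[a, b] -> is_derive x 1 p (p' x)) ->
  exists2 c, c \in `[a, b] & p b - p a = p' c * (b - a).
Proof.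
move=> ab dp.
have dp_oo x : x \in `]a, b[ -> is_derive x 1 p (p' x).
  by move=> xab; apply dp; move: xab; exact: subset_itv_oo_cc.
apply (MVT_segment ab dp_oo).
apply: derivable_within_continuous => x /dp dpx.
by have [] := dpx.
Qed.

(** The mean value theorem is applied to the difference of p and the quadratic
    polynomial, and then to its derivative. *)
Lemma taylor2_lower (R : realType) (p p' p'' : R -> R) (c t : R) : 0 <= t ->
  (forall x, x \in `[0, t] -> is_derive x 1 p (p' x)) ->
  (forall x, x \in `[0, t] -> is_derive x 1 p' (p'' x)) ->
  (forall x, x \in `[0, t] -> c <= p'' x) ->
  p 0 + p' 0 * t + c / 2 * t ^+ 2 <= p t.
Proof.
move=> t0 dp dp' cp''.
pose g x := p x - p' 0 * x - c / 2 * x ^+ 2.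
have dg x : x \in `[0, t] -> is_derive x 1 g (p' x - p' 0 - c * x).
  move=> /dp dpx; rewrite /g.
  have -> : (fun x => p x - p' 0 * x - c / 2 * x ^+ 2) =
      p - (p' 0 \*: id) - (c / 2 \*: (id ^+ 2)).
    by apply/funext => y; rewrite /= !fctE.
  apply: is_derive_eq.
  by rewrite /GRing.scale /=; field.
have [x xt gE] := MVT_derivable t0 dg.
have [x0 xt'] : 0 <= x /\ x <= t by move: xt; rewrite in_itv => /andP.
have sub y : y \in `[0, x] -> y \in `[0, t].
  by rewrite !in_itv /= => /andP[-> /le_trans->].
have [y yx p'E] := MVT_derivable x0 (fun y yx => dp' y (sub y yx)).
have cpy := cp'' y (sub y yx).
have : 0 <= (p' x - p' 0 - c * x) * t by apply: mulr_ge0 => //; nra.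
by move: gE; rewrite /g; lra.
Qed.

(** * Second derivatives in several variables *)

Lemma derive_row (R : realType) (m : nat) (g : 'rV[R]_m -> R) (h x : 'rV[R]_m) :
  differentiable g x ->
  'D_h g x = \sum_(i < m) h 0 i * 'D_(delta_mx 0 i) g x.
Proof.
move=> dg; rewrite deriveE// {1}(row_sum_delta h) linear_sum.
by apply: eq_bigr => i _; rewrite linearZ deriveE.
Qed.

(** Differentiability, unlike mere existence of the directional derivatives,
    makes 'D_h g linear in h; it is used for g near x and for each partial
    derivative of g at x. *)
Lemma derive2_hessian (R : realType) (m : nat) (U : set 'rV[R]_m)
    (g : 'rV[R]_m -> R) (h x : 'rV[R]_m) : open U -> U x -> C1_on U g ->
  (forall v, C1_on U ('D_v g)) ->
  'D_h ('D_h g) x = dotp (h *m hessian g x) h.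
Proof.
move=> oU Ux g1 g2.
rewrite (@near_eq_derive _ _ _ _
    (\sum_(j < m) (h 0 j \*: 'D_(delta_mx 0 j) g))); last first.
  near=> y; rewrite derive_row ?fct_sumE//.
  by apply g1; near: y; exact: open_nbhs_nbhs.
rewrite derive_sum => [|j]; last first.
  by apply: derivableZ; apply: diff_derivable; apply g2.
apply: eq_bigr => j _; rewrite deriveZ; last first.
  by apply: diff_derivable; apply g2.
rewrite derive_row; last by apply g2.
rewrite mxE [RHS]mulrC; congr (_ * _); apply: eq_bigr => i _.
by rewrite mxE.
Unshelve. all: by end_near. Qed.

(** The mean value theorem in the direction v, applied to the difference of g
    between two parallel edges of the parallelogram, and then in the direction
    w. The second difference on the left is symmetric in v and w, which gives
    the symmetry of second derivatives below. *)
Lemma mixed_difference (R : realType) (V : normedModType R) (U : set V)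
    (g : V -> R) (x v w : V) (s : R) : C1_on U g -> C1_on U ('D_v g) ->
  0 <= s ->
  (forall a b, a \in `[0, s] -> b \in `[0, s] -> U (x + a *: v + b *: w)) ->
  exists a b : R, [/\ a \in `[0, s], b \in `[0, s] &
    g (x + s *: v + s *: w) - g (x + s *: v) - (g (x + s *: w) - g x) =
    s ^+ 2 * 'D_w ('D_v g) (x + a *: v + b *: w)].
Proof.
move=> g1 g2 s0 sU.
have sc : s \in `[0, s] by rewrite in_itv /= lexx s0.
have zc : 0 \in `[0, s] by rewrite in_itv /= lexx s0.
pose p r := g (x + s *: w + r *: v) - g (x + r *: v).
pose p' r := 'D_v g (x + s *: w + r *: v) - 'D_v g (x + r *: v).
have dp r : r \in `[0, s] -> is_derive r 1 p (p' r).
  move=> rs; apply: is_deriveB; apply: is_derive_line; apply: diff_derivable.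
    by rewrite addrAC; apply g1; exact: sU.
  by rewrite -[x + _]addr0 -[X in _ + X](scale0r w); apply g1; exact: sU.
have [a asx pE] := MVT_derivable s0 dp.
pose q r := 'D_v g (x + a *: v + r *: w).
have dq r : r \in `[0, s] ->
    is_derive r 1 q ('D_w ('D_v g) (x + a *: v + r *: w)).
  move=> rs; apply: is_derive_line; apply: diff_derivable.
  by apply g2; exact: sU.
have [b bs qE] := MVT_derivable s0 dq.
exists a, b; split => //.
move: pE qE; rewrite /p /p' /q !scale0r !addr0 !subr0.
rewrite ![x + s *: w + _]addrAC => pE qE.
by move: pE; rewrite qE => ->; ring.
Qed.

Lemma eq_of_approx (R : realType) (V : normedModType R) (F H : V -> R) (x : V) :
  {for x, continuous F} -> {for x, continuous H} ->
  (forall r : R, 0 < r -> exists y z, [/\ ball x r y, ball x r z & F y = H z]) ->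
  F x = H x.
Proof.
move=> cF cH approx; apply/eqP; rewrite -subr_eq0 -normr_le0.
apply/ler_addgt0Pl => e e0; rewrite addr0.
have e20 : 0 < e / 2 by lra.
have /cvgrPdist_lt/(_ _ e20)/nbhs_ballP[r1 /= r10 F1] := cF.
have /cvgrPdist_lt/(_ _ e20)/nbhs_ballP[r2 /= r20 H2] := cH.
have [|y [z [xy xz FH]]] := approx (Num.min r1 r2).
  by rewrite lt_min r10 r20.
have /F1 : ball x r1 y by apply: le_ball xy; rewrite ge_min lexx.
have /H2 : ball x r2 z by apply: le_ball xz; rewrite ge_min lexx orbT.
rewrite /= FH !ltr_norml => /andP[? ?] /andP[? ?].
by rewrite ler_norml; apply/andP; split; lra.
Qed.

(** On a small parallelogram at x, the symmetric second difference of g equals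
    s ^ 2 times either mixed derivative, at two points close to x; continuity
    makes these derivatives agree at x itself. *)
Lemma derive2_sym (R : realType) (V : normedModType R) (U : set V)
    (g : V -> R) (x v w : V) : open U -> U x -> C1_on U g ->
  (forall v, C1_on U ('D_v g)) ->
  'D_w ('D_v g) x = 'D_v ('D_w g) x.
Proof.
move=> oU Ux g1 g2.
have cF := (g2 v x Ux).2 w; have cH := (g2 w x Ux).2 v.
apply (eq_of_approx cF cH) => r' r'0.
have : nbhs x U by apply: open_nbhs_nbhs; split.
move=> /nbhs_ballP[r0 /= r00 r0U].
pose r := Num.min r' r0.
have r_gt0 : 0 < r by rewrite lt_min r'0 r00.
have rP y : ball x r y -> U y.
  by move=> xy; apply: r0U; apply: le_ball xy; rewrite ge_min lexx orbT.
have rP' y : ball x r y -> ball x r' y.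
  by apply: le_ball; rewrite ge_min lexx.
(* The size s is chosen so that the whole parallelogram lies in the ball. *)
pose N := `|v| + `|w| + 1.
have N0 : 0 < N by rewrite /N ltr_wpDl// addr_ge0.
pose s := r / 2 / N.
have s0 : 0 < s by rewrite !divr_gt0.
have sN : s * N = r / 2 by rewrite divfK// gt_eqF.
have sB a b : a \in `[0, s] -> b \in `[0, s] ->
    ball x r (x + a *: v + b *: w).
  rewrite !in_itv /= => /andP[a0 las] /andP[b0 lbs].
  rewrite -ball_normE /= -addrA opprD addrA subrr add0r normrN.
  apply: le_lt_trans (ler_normD _ _) _; rewrite !normrZ !ger0_norm//.
  have : a * `|v| <= s * `|v| by apply: ler_wpM2r.
  have : b * `|w| <= s * `|w| by apply: ler_wpM2r.
  by move: sN; rewrite /N; lra.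
have sU a b : a \in `[0, s] -> b \in `[0, s] -> U (x + a *: v + b *: w).
  by move=> ac bc; apply: rP; exact: sB.
have sU' b a : b \in `[0, s] -> a \in `[0, s] -> U (x + b *: w + a *: v).
  by move=> bc ac; rewrite addrAC; exact: sU.
have [a [b [ac bc E1]]] := mixed_difference g1 (g2 v) (ltW s0) sU.
have [b' [a' [bc' ac' E2]]] := mixed_difference g1 (g2 w) (ltW s0) sU'.
exists (x + a *: v + b *: w), (x + b' *: w + a' *: v); split.
- by apply: rP'; exact: sB.
- by apply: rP'; rewrite addrAC; exact: sB.
apply: (@mulfI _ (s ^+ 2)); first by rewrite gt_eqF// exprn_gt0.
by rewrite -E1 -E2 [x + s *: w + _]addrAC; ring.
Qed.

(** The symmetry of the Hessian turns a lower bound on its real eigenvalues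
    into a lower bound on its quadratic form. *)
Lemma taylor_hessian_lower (R : realType) (m : nat) (U : set 'rV[R]_m)
    (g : 'rV[R]_m -> R) (u h : 'rV[R]_m) (b t : R) :
  open U -> C1_on U g -> (forall v, C1_on U ('D_v g)) -> 0 <= t ->
  (forall s, s \in `[0, t] -> U (u + s *: h)) ->
  (forall s, s \in `[0, t] ->
     forall l, eigenvalue (hessian g (u + s *: h)) l -> b <= l) ->
  g u + 'D_h g u * t + b * dotp h h / 2 * t ^+ 2 <= g (u + t *: h).
Proof.
move=> oU g1 g2 t0 tU spec.
have dp s : s \in `[0, t] ->
    is_derive s 1 (fun r => g (u + r *: h)) ('D_h g (u + s *: h)).
  by move=> /tU su; apply: is_derive_line; apply: diff_derivable; apply g1.
have dp' s : s \in `[0, t] -> is_derive s 1 (fun r => 'D_h g (u + r *: h))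
    ('D_h ('D_h g) (u + s *: h)).
  by move=> /tU su; apply: is_derive_line; apply: diff_derivable; apply g2.
have cp'' s : s \in `[0, t] ->
    b * dotp h h <= 'D_h ('D_h g) (u + s *: h).
  move=> st; rewrite (derive2_hessian h oU (tU s st) g1 g2).
  apply: min_eigenvalue_le_quad; last exact: spec.
  by apply/matrixP => i j; rewrite !mxE; exact: (derive2_sym _ _ oU (tU s st)).
by have := taylor2_lower t0 dp dp' cp''; rewrite scale0r addr0.
Qed.

(** * Entropy dissipation across an interface *)

Theorem proposition2p3 (R : realType) (d m : nat)
    (Omega : set 'rV[R]_m)
    (Omega_convex : @convex_set R 'rV[R]_m Omega)
    (Omega_bounded : bounded_set Omega)
    (f : 'I_d -> 'rV[R]_m -> 'rV[R]_m)
    (f_C2 : forall a, C2_closed (closure Omega) (f a))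
    (f_diag : forall a u, closure Omega u -> diagonalizable ('J (f a) u))
    (eta : 'rV[R]_m -> R)
    (eta_C2 : C2_closed (closure Omega) eta)
    (eta_ge0 : forall u, closure Omega u -> 0 <= eta u)
    (beta0 beta1 : R) (beta0_gt0 : 0 < beta0) (beta01 : beta0 <= beta1)
    (eta_spec : forall u, closure Omega u ->
       forall l : R, eigenvalue (hessian eta u) l -> beta0 <= l <= beta1)
    (xi : 'I_d -> 'rV[R]_m -> R)
    (xi_C2 : forall a, C2_closed (closure Omega) (xi a))
    (xi_compat : forall a u, Omega u ->
       forall h, 'd (xi a) u h = 'd eta u ('d (f a) u h))
    (T : Type) (cell : T -> set 'rV[R]_d) (cell_mesh : is_mesh cell)
    (n : T -> T -> 'rV[R]_d) (n_normal : is_interface_normal cell n)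
    (G : T -> T -> 'rV[R]_m -> 'rV[R]_m -> 'rV[R]_m)
    (G_lip : forall K L, neighbours cell K L ->
       [lipschitz (G K L uv.1 uv.2) | uv in Omega `*` Omega])
    (G_conserv : forall K L, neighbours cell K L ->
       forall u v, Omega u -> Omega v -> G K L u v = - G L K v u)
    (G_consist : forall K L, neighbours cell K L ->
       forall u, Omega u -> G K L u u = flux_dot f u (n K L))
    (lstar : R) (lstar_gt0 : 0 < lstar)
    (G_invariant : forall K L, neighbours cell K L ->
       forall lambda, lstar < lambda -> forall u v, Omega u -> Omega v ->
       Omega (u - lambda^-1 *: (G K L u v - flux_dot f u (n K L))))
    (xiG : T -> T -> 'rV[R]_m -> 'rV[R]_m -> R)
    (xiG_lip : forall K L, neighbours cell K L ->
       [lipschitz (xiG K L uv.1 uv.2) | uv in Omega `*` Omega])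
    (xiG_conserv : forall K L, neighbours cell K L ->
       forall u v, Omega u -> Omega v -> xiG K L u v = - xiG L K v u)
    (xiG_entropy : forall K L, neighbours cell K L ->
       forall lambda, lstar <= lambda -> forall u v, Omega u -> Omega v ->
       xiG K L u v - entropy_flux_dot xi u (n K L) <=
       - lambda * (eta (u - lambda^-1 *: (G K L u v - flux_dot f u (n K L)))
                   - eta u)) :
  let X K L u v := entropy_flux_dot xi u (n K L)
                   + 'd eta u (G K L u v - flux_dot f u (n K L)) in
  forall K L, neighbours cell K L -> forall u v, Omega u -> Omega v ->
    X K L u v - xiG K L u v >=
    beta0 / (2 * lstar) * enorm (G K L u v - flux_dot f u (n K L)) ^+ 2.
Proof.
move=> X K L KL u v Ou Ov; rewrite /X; clear X.
set w := G K L u v - flux_dot f u (n K L).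
have [U [oU OU eta1 eta2]] := eta_C2.
(* The entropy inequality at lambda = lstar / t for 0 < t < 1 only involves the
   half-open segment towards u - w / lstar, which stays in Omega. *)
have inO s : 0 <= s -> s < 1 -> Omega (u + s *: (- lstar^-1 *: w)).
  rewrite le_eqVlt => /predU1P[<- _|s0 s1]; first by rewrite scale0r addr0.
  have := G_invariant _ _ KL (lstar / s) _ u v Ou Ov.
  rewrite ltr_pdivlMr// gtr_pMr// => /(_ s1).
  by rewrite invf_div scalerA mulrN scaleNr.
have key t : 0 < t -> t < 1 ->
    beta0 * t / (2 * lstar) * enorm w ^+ 2 <=
    entropy_flux_dot xi u (n K L) + 'd eta u w - xiG K L u v.
  move=> t0 t1.
  set h := - lstar^-1 *: w.
  have inU s : s \in `[0, t] -> Omega (u + s *: h).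
    by rewrite in_itv /= => /andP[s0 st]; apply: inO => //; exact: le_lt_trans t1.
  have inU' s : s \in `[0, t] -> U (u + s *: h).
    by move=> /inU ?; apply: OU; exact: subset_closure.
  have spec s : s \in `[0, t] ->
      forall l, eigenvalue (hessian eta (u + s *: h)) l -> beta0 <= l.
    move=> /inU su l /(eta_spec _ (subset_closure su)).
    by case/andP.
  have taylor := taylor_hessian_lower oU eta1 eta2 (ltW t0) inU' spec.
  have lt0 : 0 < lstar / t by rewrite divr_gt0.
  have le_lt : lstar <= lstar / t by rewrite ler_pdivlMr// ger_pMr// ltW.
  have := xiG_entropy _ _ KL _ le_lt u v Ou Ov.
  rewrite -/w invf_div.
  have -> : u - (t / lstar) *: w = u + t *: h.
    by rewrite /h scalerA mulrN scaleNr.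
  have dh : 'D_h eta u = - lstar^-1 * 'd eta u w.
    rewrite deriveE ?linearZ//.
    by have := inU' 0; rewrite scale0r addr0 in_itv /= lexx (ltW t0) => /(_ isT)/eta1[].
  have hh : dotp h h = lstar^-1 ^+ 2 * dotp w w.
    by rewrite dotpZl dotpZr mulrA -expr2 sqrrN.
  move: taylor; rewrite dh hh enorm_sqr.
  move: (eta _) (eta u) ('d eta u w) (dotp w w) => e1 e0 dw ww taylor.
  move/(ler_wpM2l (ltW lt0)) : taylor.
  rewrite [leLHS](_ : _ = lstar / t * e0 - dw + beta0 * t / (2 * lstar) * ww); last first.
    by field; rewrite !gt_eqF.
  by move=> ? ?; lra.
move: key; set B := _ - xiG K L u v; set N := enorm w ^+ 2 => key.
set A := beta0 / (2 * lstar) * N.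
have {}key t : 0 < t -> t < 1 -> t * A <= B.
  move=> t0 t1; apply: le_trans (key t t0 t1).
  by rewrite /A le_eqVlt; apply/orP; left; apply/eqP; field; rewrite gt_eqF.
have A0 : 0 <= A.
  by rewrite /A mulr_ge0 ?sqr_ge0// divr_ge0 ?mulr_ge0 ?ltW.
(* Letting t tend to 1: if B < A, the value of t making t * A the midpoint of A
   and B is a contradiction. *)
rewrite leNgt; apply/negP => BA.
have B0 : 0 <= B.
  by have := key 2^-1; rewrite invr_gt0 ltr0n invf_lt1 ?ltr1n// => /(_ isT isT); lra.
have A1 : 0 < A by lra.
have := key ((A + B) / (2 * A)).
rewrite divr_gt0 ?ltr_pdivrMr//; [|lra..].
move=> /(_ isT); have -> : A + B < 1 * (2 * A) by lra.
move=> /(_ isT).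
have -> : (A + B) / (2 * A) * A = (A + B) / 2 by field; rewrite gt_eqF.
by lra.
Qed.
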